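(* Suppose that $x_0,\dots,x_N\in\mathbb{R}^{n_x}$, $u_0,\dots,u_{N-1}\in\mathbb{R}^{n_u}$, $\lambda_0,\dots,\lambda_N\in\mathbb{R}^{n_x}$ and $\nu\in\mathbb{R}^{n_c}$ satisfy the second-order sufficient conditions (SOSC) of the transformed optimal control problem. Then there exist Lagrange multipliers $\lambda_0^*,\dots,\lambda_N^*\in\mathbb{R}^{n_x}$ and $\nu^*\in\mathbb{R}^{n_c}$ such that $x_0,\dots,x_N$, $u_0,\dots,u_{N-1}$, $\lambda_0^*,\dots,\lambda_N^*$ and $\nu^*$ satisfy the SOSC of the original optimal control problem.
   Context: Notation. Subscripts denote partial derivatives: $h_x$ is the Jacobian of $h$ with respect to $x$ (a row vector if $h$ is scalar-valued), and for scalar $h$, $h_{xx},h_{xu},h_{uu}$ are the blocks of second partial derivatives. Data. Let $n,n_u,n_c,N,k$ be positive integers with $n_u\le n$, $n_c\le n$, $2\le k\le N-1$, and let $n_x=2n$. States are written $x=\begin{bmatrix} q^{\rm T} & v^{\rm T}\end{bmatrix}^{\rm T}\in\mathbb{R}^{n_x}$ with $q,v\in\mathbb{R}^n$ (generalized coordinates and velocity). The functions $\varphi:\mathbb{R}^{n_x}\to\mathbb{R}$, $L:\mathbb{R}^{n_x}\times\mathbb{R}^{n_u}\to\mathbb{R}$, $f:\mathbb{R}^{n_x}\times\mathbb{R}^{n_u}\to\mathbb{R}^{n_x}$, $\phi:\mathbb{R}^{n_x}\to\mathbb{R}^{n_c}$ are twice continuously differentiable, and $\bar x\in\mathbb{R}^{n_x}$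 is given. The function $f$ has the form $$f(x,u)=\begin{bmatrix} f^{(q)}(x)\\ f^{(v)}(x,u)\end{bmatrix},\qquad f^{(q)}(x),\,f^{(v)}(x,u)\in\mathbb{R}^n,$$ and $\phi$ depends only on the generalized coordinate, i.e. $\phi_x(x)=\begin{bmatrix}\phi_q(q) & O\end{bmatrix}$ with $\phi_q(q)\in\mathbb{R}^{n_c\times n}$. Define $g(x):=\begin{bmatrix} f^{(q)}(x)\\ 0\end{bmatrix}\in\mathbb{R}^{n_x}$. Original optimal control problem: find $x_0,\dots,x_N$, $u_0,\dots,u_{N-1}$ minimizing $J=\varphi(x_N)+\sum_{i=0}^{N-1}L(x_i,u_i)$ subject to (a) $x_i+f(x_i,u_i)-x_{i+1}=0$ for $i\in\{0,\dots,N-1\}$; (b) $x_0-\bar x=0$; (c) $\phi(x_k)=0$. Transformed optimal control problem: minimize the same $J$ subject to (a), (b) and, in place of (c), (c') $\phi\bigl(x_{k-2}+f(x_{k-2},u_{k-2})+g(x_{k-2}+f(x_{k-2},u_{k-2}))\bigr)=0$. Hamiltonians: $H(x,u,\lambda):=L(x,u)+\lambda^{\rm T}f(x,u)$ and $\tilde H(x,u,\lambda,\nu):=H(x,u,\lambda)+\nu^{\rm T}\phi\bigl(x+f(x,u)+g(x+f(x,u))\bigr)$. FONC of the transformed problem (for $x_i,u_i,\lambda_i,\nu$): the constraints (a), (b), (c') hold, and - $\varphi_x^{\rm T}(x_N)-\lambda_N=0$; - $H_x^{\rm T}(x_i,u_i,\lambda_{i+1})+\lambda_{i+1}-\lambda_i=0$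 and $H_u^{\rm T}(x_i,u_i,\lambda_{i+1})=0$ for all $i\in\{0,\dots,N-1\}\setminus\{k-2\}$; - $\tilde H_x^{\rm T}(x_{k-2},u_{k-2},\lambda_{k-1},\nu)+\lambda_{k-1}-\lambda_{k-2}=0$ and $\tilde H_u^{\rm T}(x_{k-2},u_{k-2},\lambda_{k-1},\nu)=0$. FONC of the original problem (for $x_i,u_i,\lambda_i^*,\nu^*$): the constraints (a), (b), (c) hold, and - $\varphi_x^{\rm T}(x_N)-\lambda_N^*=0$; - $H_x^{\rm T}(x_i,u_i,\lambda_{i+1}^* )+\lambda_{i+1}^*-\lambda_i^*=0$ for all $i\in\{0,\dots,N-1\}\setminus\{k\}$; - $H_x^{\rm T}(x_k,u_k,\lambda_{k+1}^* )+\phi_x^{\rm T}(x_k)\nu^*+\lambda_{k+1}^*-\lambda_k^*=0$; - $H_u^{\rm T}(x_i,u_i,\lambda_{i+1}^* )=0$ for all $i\in\{0,\dots,N-1\}$. SOSC of the transformed problem (for $x_i,u_i,\lambda_i,\nu$): the FONC of the transformed problem hold, and $$\delta x_N^{\rm T}Q_{xx,N}\delta x_N+\sum_{i=0}^{N-1}\begin{bmatrix}\delta x_i\\ \delta u_i\end{bmatrix}^{\rm T}\begin{bmatrix}Q_{xx,i}&Q_{xu,i}\\ Q_{xu,i}^{\rm T}&Q_{uu,i}\end{bmatrix}\begin{bmatrix}\delta x_i\\ \delta u_i\end{bmatrix}>0$$ for all $(\delta x_0,\dots,\delta x_N,\delta u_0,\dots,\delta u_{N-1})$, not all zero, satisfying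 $\delta x_0=0$, $(I+f_x(x_i,u_i))\delta x_i+f_u(x_i,u_i)\delta u_i-\delta x_{i+1}=0$ for $i\in\{0,\dots,N-1\}$, and $\phi_x(I+g_x)(I+f_x(x_{k-2},u_{k-2}))\delta x_{k-2}+\phi_x(I+g_x)f_u(x_{k-2},u_{k-2})\delta u_{k-2}=0$. Here $g_x$ is evaluated at $x_{k-2}+f(x_{k-2},u_{k-2})$ and $\phi_x$ at $x_{k-2}+f(x_{k-2},u_{k-2})+g(x_{k-2}+f(x_{k-2},u_{k-2}))$. The matrices are $Q_{xx,N}=\varphi_{xx}(x_N)$; for $i\ne k-2$, $Q_{xx,i},Q_{xu,i},Q_{uu,i}$ are $H_{xx},H_{xu},H_{uu}$ at $(x_i,u_i,\lambda_{i+1})$; for $i=k-2$ they are $\tilde H_{xx},\tilde H_{xu},\tilde H_{uu}$ at $(x_{k-2},u_{k-2},\lambda_{k-1},\nu)$. SOSC of the original problem (for $x_i,u_i,\lambda_i^*,\nu^*$): the FONC of the original problem hold, and $$(\delta x_N^* )^{\rm T}Q_{xx,N}^*\delta x_N^*+\sum_{i=0}^{N-1}\begin{bmatrix}\delta x_i^*\\ \delta u_i^*\end{bmatrix}^{\rm T}\begin{bmatrix}Q_{xx,i}^*&Q_{xu,i}^*\\ (Q_{xu,i}^* )^{\rm T}&Q_{uu,i}^*\end{bmatrix}\begin{bmatrix}\delta x_i^*\\ \delta u_i^*\end{bmatrix}>0$$ for all $(\delta x_0^*,\dots,\delta x_N^*,\delta u_0^*,\dots,\delta u_{N-1}^* )$,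 not all zero, satisfying $\delta x_0^*=0$, $(I+f_x(x_i,u_i))\delta x_i^*+f_u(x_i,u_i)\delta u_i^*-\delta x_{i+1}^*=0$ for $i\in\{0,\dots,N-1\}$, and $\phi_x(x_k)\delta x_k^*=0$. The matrices are $Q_{xx,N}^*=\varphi_{xx}(x_N)$; for $i\ne k$, $Q_{xx,i}^*,Q_{xu,i}^*,Q_{uu,i}^*$ are $H_{xx},H_{xu},H_{uu}$ at $(x_i,u_i,\lambda_{i+1}^* )$; for $i=k$ they are the second partial derivatives in $(x,u)$, at $(x_k,u_k)$, of the function $H(x,u,\lambda_{k+1}^* )+(\nu^* )^{\rm T}\phi(x)$. *)

(* Defs.v *)
From mathcomp Require Import all_boot all_order all_algebra.
From mathcomp Require Import all_classical all_reals all_analysis.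

Set Implicit Arguments.
Unset Strict Implicit.
Unset Printing Implicit Defensive.

Import Order.TTheory GRing.Theory Num.Theory.
Import numFieldNormedType.Exports.

Local Open Scope classical_set_scope.
Local Open Scope ring_scope.

(* The spaces are meant to be finite-dimensional, where continuity of the
   derivative in the operator norm is continuity of 'D_v h for every v. *)
Definition C1 (R : realType) (V W : normedModType R) (h : V -> W) : Prop :=
  (forall p, differentiable h p) /\ (forall v, continuous ('D_v h)).

Definition C2 (R : realType) (V W : normedModType R) (h : V -> W) : Prop :=
  (forall p, differentiable h p) /\ (forall v, C1 ('D_v h)).

(* Rows of [jac] are indexed by the components of h and columns by the
   variables; this is the transpose of the library's ['J h x], which is meant
   for row vectors. *)
Definition jac (R : realType) (m p : nat) (h : 'cV[R]_m -> 'cV[R]_p)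
    (x : 'cV[R]_m) : 'M[R]_(p, m) :=
  \matrix_(i, j) 'D_(delta_mx j ord0) (fun y => h y i ord0) x.

Definition grad (R : realType) (m : nat) (h : 'cV[R]_m -> R)
    (x : 'cV[R]_m) : 'rV[R]_m :=
  \row_j 'D_(delta_mx j ord0) h x.

Definition hess (R : realType) (m : nat) (h : 'cV[R]_m -> R)
    (x : 'cV[R]_m) : 'M[R]_m :=
  jac (fun y => (grad h y)^T) x.

Section TwoVariables.
Context {R : realType} {m p r : nat}.

Definition jacx (h : 'cV[R]_m -> 'cV[R]_p -> 'cV[R]_r) x u : 'M[R]_(r, m) :=
  jac (fun y => h y u) x.
Definition jacu (h : 'cV[R]_m -> 'cV[R]_p -> 'cV[R]_r) x u : 'M[R]_(r, p) :=
  jac (h x) u.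

Definition gradx (h : 'cV[R]_m -> 'cV[R]_p -> R) x u : 'rV[R]_m :=
  grad (fun y => h y u) x.
Definition gradu (h : 'cV[R]_m -> 'cV[R]_p -> R) x u : 'rV[R]_p :=
  grad (h x) u.

Definition hessxx (h : 'cV[R]_m -> 'cV[R]_p -> R) x u : 'M[R]_m :=
  hess (fun y => h y u) x.
Definition hessxu (h : 'cV[R]_m -> 'cV[R]_p -> R) x u : 'M[R]_(m, p) :=
  jac (fun w => (gradx h x w)^T) u.
Definition hessuu (h : 'cV[R]_m -> 'cV[R]_p -> R) x u : 'M[R]_p :=
  hess (h x) u.

End TwoVariables.

Definition qform (R : realType) (m : nat) (Q : 'M[R]_m) (d : 'cV[R]_m) : R :=
  (d^T *m Q *m d) ord0 ord0.

Definition hess_block (R : realType) (m p : nat)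
    (h : 'cV[R]_m -> 'cV[R]_p -> R) x u : 'M[R]_(m + p) :=
  block_mx (hessxx h x u) (hessxu h x u) (hessxu h x u)^T (hessuu h x u).

(* The state space R^(2n) is 'cV[R]_(n + n): the upper block [usubmx x] is q
   and the lower block [dsubmx x] is v.  Trajectories x_0..x_N, u_0..u_(N-1)
   and multipliers are functions on nat of which only the values at these
   indices are ever used. *)
Section OptimalControl.
Context {R : realType} {n nu nc : nat}.

Definition gmap (fq : 'cV[R]_(n + n) -> 'cV[R]_n) (x : 'cV[R]_(n + n)) :
    'cV[R]_(n + n) := col_mx (fq x) 0.

Context (N k : nat).
Context (varphi : 'cV[R]_(n + n) -> R).
Context (L : 'cV[R]_(n + n) -> 'cV[R]_nu -> R).
Context (f : 'cV[R]_(n + n) -> 'cV[R]_nu -> 'cV[R]_(n + n)).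
Context (fq : 'cV[R]_(n + n) -> 'cV[R]_n).
Context (phi : 'cV[R]_(n + n) -> 'cV[R]_nc).
Context (xbar : 'cV[R]_(n + n)).

Definition next (x : 'cV[R]_(n + n)) (u : 'cV[R]_nu) : 'cV[R]_(n + n) :=
  x + f x u.

Definition next2 (x : 'cV[R]_(n + n)) (u : 'cV[R]_nu) : 'cV[R]_(n + n) :=
  next x u + gmap fq (next x u).

Definition Ham (x : 'cV[R]_(n + n)) (u : 'cV[R]_nu)
    (lam : 'cV[R]_(n + n)) : R :=
  L x u + (lam^T *m f x u) ord0 ord0.

Definition Hamt (x : 'cV[R]_(n + n)) (u : 'cV[R]_nu)
    (lam : 'cV[R]_(n + n)) (mu : 'cV[R]_nc) : R :=
  Ham x u lam + (mu^T *m phi (next2 x u)) ord0 ord0.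

Definition Hamc (x : 'cV[R]_(n + n)) (u : 'cV[R]_nu)
    (lam : 'cV[R]_(n + n)) (mu : 'cV[R]_nc) : R :=
  Ham x u lam + (mu^T *m phi x) ord0 ord0.

Definition dynamics (x : nat -> 'cV[R]_(n + n)) (u : nat -> 'cV[R]_nu) : Prop :=
  (forall i, (i < N)%N -> x i + f (x i) (u i) - x i.+1 = 0) /\
  x 0%N - xbar = 0.

Definition fonc_transformed (x : nat -> 'cV[R]_(n + n))
    (u : nat -> 'cV[R]_nu) (lam : nat -> 'cV[R]_(n + n))
    (mu : 'cV[R]_nc) : Prop :=
  [/\ dynamics x u,
      phi (next2 (x (k - 2)%N) (u (k - 2)%N)) = 0,
      (grad varphi (x N))^T - lam N = 0,
      forall i, (i < N)%N -> i <> (k - 2)%N ->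
        (gradx (fun y w => Ham y w (lam i.+1)) (x i) (u i))^T
          + lam i.+1 - lam i = 0 /\
        (gradu (fun y w => Ham y w (lam i.+1)) (x i) (u i))^T = 0 &
      (gradx (fun y w => Hamt y w (lam (k - 1)%N) mu)
             (x (k - 2)%N) (u (k - 2)%N))^T
          + lam (k - 1)%N - lam (k - 2)%N = 0 /\
      (gradu (fun y w => Hamt y w (lam (k - 1)%N) mu)
             (x (k - 2)%N) (u (k - 2)%N))^T = 0].

Definition fonc_original (x : nat -> 'cV[R]_(n + n))
    (u : nat -> 'cV[R]_nu) (lam : nat -> 'cV[R]_(n + n))
    (mu : 'cV[R]_nc) : Prop :=
  [/\ dynamics x u,
      phi (x k) = 0,
      (grad varphi (x N))^T - lam N = 0,
      forall i, (i < N)%N -> i <> k ->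
        (gradx (fun y w => Ham y w (lam i.+1)) (x i) (u i))^T
          + lam i.+1 - lam i = 0 &
      (gradx (fun y w => Ham y w (lam k.+1)) (x k) (u k))^T
          + (jac phi (x k))^T *m mu + lam k.+1 - lam k = 0 /\
      forall i, (i < N)%N ->
        (gradu (fun y w => Ham y w (lam i.+1)) (x i) (u i))^T = 0].

Definition lin_dynamics (x : nat -> 'cV[R]_(n + n)) (u : nat -> 'cV[R]_nu)
    (dx : nat -> 'cV[R]_(n + n)) (du : nat -> 'cV[R]_nu) : Prop :=
  dx 0%N = 0 /\
  forall i, (i < N)%N ->
    (1%:M + jacx f (x i) (u i)) *m dx i + jacu f (x i) (u i) *m du i
      - dx i.+1 = 0.

Definition not_all_zero (dx : nat -> 'cV[R]_(n + n))
    (du : nat -> 'cV[R]_nu) : Prop :=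
  (exists2 i, (i <= N)%N & dx i <> 0) \/ (exists2 i, (i < N)%N & du i <> 0).

(* [h i] is the stage function whose second derivatives at (x_i, u_i) give
   Q_{xx,i}, Q_{xu,i}, Q_{uu,i}. *)
Definition second_variation
    (h : nat -> 'cV[R]_(n + n) -> 'cV[R]_nu -> R)
    (x : nat -> 'cV[R]_(n + n)) (u : nat -> 'cV[R]_nu)
    (dx : nat -> 'cV[R]_(n + n)) (du : nat -> 'cV[R]_nu) : R :=
  qform (hess varphi (x N)) (dx N)
  + \sum_(i < N) qform (hess_block (h i) (x i) (u i)) (col_mx (dx i) (du i)).

Definition sosc_transformed (x : nat -> 'cV[R]_(n + n))
    (u : nat -> 'cV[R]_nu) (lam : nat -> 'cV[R]_(n + n))
    (mu : 'cV[R]_nc) : Prop :=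
  fonc_transformed x u lam mu /\
  forall (dx : nat -> 'cV[R]_(n + n)) (du : nat -> 'cV[R]_nu),
    not_all_zero dx du ->
    lin_dynamics x u dx du ->
    (let xa := x (k - 2)%N in
     let ua := u (k - 2)%N in
     let P := jac phi (next2 xa ua) *m (1%:M + jac (gmap fq) (next xa ua)) in
     P *m (1%:M + jacx f xa ua) *m dx (k - 2)%N
       + P *m jacu f xa ua *m du (k - 2)%N = 0) ->
    0 < second_variation
          (fun i y w => if i == (k - 2)%N then Hamt y w (lam (k - 1)%N) mu
                        else Ham y w (lam i.+1))
          x u dx du.

Definition sosc_original (x : nat -> 'cV[R]_(n + n))
    (u : nat -> 'cV[R]_nu) (lam : nat -> 'cV[R]_(n + n))
    (mu : 'cV[R]_nc) : Prop :=
  fonc_original x u lam mu /\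
  forall (dx : nat -> 'cV[R]_(n + n)) (du : nat -> 'cV[R]_nu),
    not_all_zero dx du ->
    lin_dynamics x u dx du ->
    jac phi (x k) *m dx k = 0 ->
    0 < second_variation
          (fun i y w => if i == k then Hamc y w (lam k.+1) mu
                        else Ham y w (lam i.+1))
          x u dx du.

End OptimalControl.

(* Main.v *)
Require Import Defs.
From HB Require Import structures.
From mathcomp Require Import all_boot all_order all_algebra.
From mathcomp Require Import all_classical all_reals all_analysis.
From mathcomp Require Import ring.
Import Order.TTheory GRing.Theory Num.Theory.
Import numFieldNormedType.Exports.
Local Open Scope classical_set_scope.
Local Open Scope ring_scope.

(** Put F(x, u) = x + f(x, u) and e = mu^T phi.  Since phi only sees q and the
    q-part of F(y, w) is that of y + g(y), the function c(y) = e(F(y, w)) does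
    not depend on w, and the term added in the transformed Hamiltonian is
    c(F(x, u)).  The multipliers of the original problem are mu itself and the
    lambda_i, except that (grad c)(x_(k-1)) is added to lambda_(k-1) and
    (grad e)(x_k) to lambda_k.  Differentiating e(F(y, w)) = c(y) once gives the
    first-order conditions and shows that both problems have the same tangent
    directions; differentiating it twice shows that the stage terms of the two
    second variations (original minus transformed) differ by -c''[dx_(k-1)] at
    k-2, by c''[dx_(k-1)] - e''[dx_k] at k-1 and by e''[dx_k] at k; these sum
    to zero. *)

(* Loading path.v after Defs hides [Defs.next]. *)
Local Notation next := Defs.next.

(** * Directional derivatives: chain rule and symmetry of second derivatives *)

Lemma derive_comp {R : realType} {U V W : normedModType R}
    (g : V -> W) (h : U -> V) (z v : U) :
  differentiable h z -> differentiable g (h z) ->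
  'D_v (g \o h) z = 'D_('D_v h z) g (h z).
Proof.
move=> dh dg; rewrite !deriveE //; last exact: differentiable_comp.
by rewrite diff_comp.
Qed.

Lemma is_derive_line {R : realType} {V W : normedModType R} (h : V -> W)
    (p v : V) (s : R) : differentiable h (p + s *: v) ->
  is_derive s 1 (fun s => h (p + s *: v)) ('D_v h (p + s *: v)).
Proof.
move=> dh.
have dl : is_diff s (cst p + *:%R ^~ v) (0 + *:%R ^~ v).
  exact: is_diffD.
have -> : (fun s => h (p + s *: v)) = h \o (cst p + *:%R ^~ v) by [].
apply: DeriveDef.
  by apply/diff_derivable/differentiable_comp.
rewrite derive_comp //; congr ('D_ _ h _).
rewrite deriveE// diff_val.
by transitivity (0 + 1 *: v); rewrite ?add0r ?scale1r.
Qed.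

(** Young's argument: the mean value theorem turns the second difference into [t] times an increment
    of ['D_v h], and the first-order expansion of ['D_v h] at [z] evaluates that increment up to
    o([t]). *)
Lemma second_difference_bound {R : realType} {V : normedModType R}
    (h : V -> R) (z v w : V) (e : R) :
  (forall p, differentiable h p) -> differentiable ('D_v h) z -> 0 < e ->
  \forall t \near 0^'+,
    `|h (z + t *: v + t *: w) - h (z + t *: v) - h (z + t *: w) + h z
      - t ^+ 2 * 'D_w ('D_v h) z| <= e * t ^+ 2.
Proof.
move=> dh dg e0.
set g : V -> R := 'D_v h.
(* Both displacements [t *: w + c *: v] and [c *: v] have norm at most [t * M]; the summand 1 keeps
   [M] positive when [v] and [w] vanish. With [e'], the two expansion errors add up to at most
   [e * t]. *)
pose M := `|v| + `|w| + 1.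
have M0 : 0 < M by rewrite ltr_wpDl// addr_ge0.
pose e' := e / (2 * M).
have e'0 : 0 < e' by rewrite divr_gt0// mulr_gt0.
have [r r0 gr] : exists2 r, 0 < r & forall y, `|y| < r ->
    `|g (z + y) - g z - 'd g z y| <= e' * `|y|.
  have /eqaddoP /(_ _ e'0) /nbhs_ballP[r r0 H] := diff_locally dg.
  exists r => // y yr; rewrite -addrA -opprD (addrC z); apply: H.
  by rewrite -ball_normE /= sub0r normrN.
near=> t.
have t0 : 0 < t by near: t; exact: nbhs_right_gt.
have tr : t * M < r.
  rewrite -ltr_pdivlMr//; near: t; apply: nbhs_right_lt; exact: divr_gt0.
(* Apply the mean value theorem to the first difference along [w], as a function
   of the displacement along [v]. *)
pose p s := h (z + t *: w + s *: v) - h (z + s *: v).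
pose dp s := g (z + t *: w + s *: v) - g (z + s *: v).
have pdp (s : R) : is_derive s (1 : R) p (dp s).
  by apply: is_deriveB; apply: is_derive_line.
have [|c] := @MVT _ p dp 0 t t0 (fun s _ => pdp s).
  apply: continuous_subspaceT => s; apply: differentiable_continuous.
  by apply/derivable1_diffP; have [] := pdp s.
rewrite in_itv /= => /andP[c0 ct]; rewrite /p /dp !scale0r !addr0 subr0.
move=> pE.
have -> : h (z + t *: v + t *: w) - h (z + t *: v) - h (z + t *: w) + h z
      - t ^+ 2 * 'D_w g z =
    ((g (z + (t *: w + c *: v)) - g z - 'd g z (t *: w + c *: v))
     - (g (z + c *: v) - g z - 'd g z (c *: v))) * t.
  have -> : 'd g z (t *: w + c *: v) = t * 'd g z w + 'd g z (c *: v).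
    by rewrite linearD linearZ.
  rewrite deriveE// (addrA z) (addrAC z (t *: v)).
  rewrite (_ : h _ - _ - _ + _ - _ = (h (z + t *: w + t *: v) - h (z + t *: v) -
    (h (z + t *: w) - h z)) - t ^+ 2 * 'd g z w); last by ring.
  by rewrite pE; ring.
have cv : `|c *: v| <= t * `|v|.
  by rewrite normrZ gtr0_norm// ler_wpM2r// ltW.
have twcv : `|t *: w + c *: v| <= t * M.
  apply: le_trans (ler_normD _ _) _; rewrite normrZ gtr0_norm//.
  rewrite /M (addrC `|v|) !mulrDr mulr1 -addrA lerD2l.
  by rewrite (le_trans cv)// lerDl ltW.
have cvM : `|c *: v| <= t * M.
  apply: le_trans cv _; rewrite ler_pM2l// /M -addrA lerDl.
  by rewrite addr_ge0.
rewrite normrM (gtr0_norm t0) expr2 mulrA ler_pM2r//.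
apply: le_trans (ler_normB _ _) _.
have -> : e * t = e' * (t * M) + e' * (t * M).
  by rewrite /e'; field; rewrite gt_eqF.
apply: lerD.
  by apply: le_trans (gr _ (le_lt_trans twcv tr)) _; rewrite ler_pM2l.
by apply: le_trans (gr _ (le_lt_trans cvM tr)) _; rewrite ler_pM2l.
Unshelve. all: by end_near. Qed.

(** The second difference is symmetric in [v] and [w], and both mixed derivatives times [t ^+ 2] lie
    within [e / 2 * t ^+ 2] of it; one common small [t] for each [e] suffices. *)
Lemma derive_sym {R : realType} {V : normedModType R} (h : V -> R) (z v w : V) :
  (forall p, differentiable h p) ->
  differentiable ('D_v h) z -> differentiable ('D_w h) z ->
  'D_w ('D_v h) z = 'D_v ('D_w h) z.
Proof.
move=> dh dv dw; apply/eqP; rewrite -subr_eq0 -normr_le0.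
apply/ler_addgt0Pl => e e0; rewrite addr0.
have e20 : 0 < e / 2 by rewrite divr_gt0.
have A := second_difference_bound h z v w (e / 2) dh dv e20.
have B := second_difference_bound h z w v (e / 2) dh dw e20.
have [t [[/= At Bt] t_gt0]] :=
  filter_ex (filterI (filterI A B) (nbhs_right_gt 0)).
have t0 : 0 < t ^+ 2 by rewrite exprn_gt0.
rewrite -(ler_pM2r t0) -[X in _ * X <= _](gtr0_norm t0) -normrM.
have -> : e * t ^+ 2 = e / 2 * t ^+ 2 + e / 2 * t ^+ 2 by field.
move: Bt At; rewrite (addrAC z (t *: w)).
move: ('D_w _ z) ('D_v _ z) (h _) (h _) (h _) => a b h2 h3 h1 Bt At.
rewrite (_ : (a - b) * t ^+ 2 = h1 - h3 - h2 + h z - t ^+ 2 * b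
    - (h1 - h2 - h3 + h z - t ^+ 2 * a)); last by ring.
exact: le_trans (ler_normB _ _) (lerD Bt At).
Qed.

(** * Twice differentiable functions: linear maps, sums and compositions *)

(* Weaker than [C2], but closed under composition and already enough for the
   symmetry of second derivatives. *)
Definition diff2 {R : realType} {V W : normedModType R} (h : V -> W) : Prop :=
  (forall p, differentiable h p) /\ (forall v p, differentiable ('D_v h) p).

Lemma C2_diff2 {R : realType} {V W : normedModType R} (h : V -> W) :
  C2 h -> diff2 h.
Proof. by move=> [dh dDh]; split=> // v; have [] := dDh v. Qed.

Lemma derive_linear {R : realType} {V W : normedModType R}
    (h : {linear V -> W}) (v p : V) : continuous h -> 'D_v h p = h v.
Proof.
by move=> ch; rewrite deriveE ?diff_lin//; apply: linear_differentiable.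
Qed.

Lemma diff2_linear {R : realType} {V W : normedModType R}
    (h : {linear V -> W}) : continuous h -> diff2 h.
Proof.
move=> ch; split=> [p|v p]; first exact: linear_differentiable.
rewrite (_ : 'D_v h = cst (h v)); first exact: differentiable_cst.
by apply/funext => q; exact: derive_linear.
Qed.

Lemma derive2_linear {R : realType} {V W : normedModType R}
    (h : {linear V -> W}) (v p : V) : continuous h -> 'D_v ('D_v h) p = 0.
Proof.
move=> ch; rewrite (_ : 'D_v h = cst (h v)) ?derive_cst//.
by apply/funext => q; exact: derive_linear.
Qed.

Lemma deriveDdir {R : realType} {V W : normedModType R} (h : V -> W)
    (p v w : V) :
  differentiable h p -> 'D_(v + w) h p = 'D_v h p + 'D_w h p.
Proof. by move=> dh; rewrite !deriveE// linearD. Qed.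

Lemma derive_sumdir {R : realType} {V W : normedModType R} (h : V -> W) (p : V)
    m (a : 'I_m -> R) (e : 'I_m -> V) : differentiable h p ->
  'D_(\sum_i a i *: e i) h p = \sum_i a i *: 'D_(e i) h p.
Proof.
move=> dh; rewrite deriveE// linear_sum; apply: eq_bigr => i _.
by rewrite linearZ deriveE.
Qed.

Section Sum.
Context {R : realType} {V W : normedModType R} {f g : V -> W}.
Hypothesis (df : diff2 f) (dg : diff2 g).

Lemma derive_add (v : V) : 'D_v (f + g) = 'D_v f + 'D_v g.
Proof.
apply/funext => p; rewrite deriveD//; apply: diff_derivable.
  exact: df.1.
exact: dg.1.
Qed.

Lemma diff2D : diff2 (f + g).
Proof.
split=> [p|v p]; first by apply: differentiableD; [exact: df.1|exact: dg.1].
by rewrite derive_add; apply: differentiableD; [exact: df.2|exact: dg.2].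
Qed.

Lemma derive2D (v p : V) :
  'D_v ('D_v (f + g)) p = 'D_v ('D_v f) p + 'D_v ('D_v g) p.
Proof.
rewrite derive_add deriveD//; apply: diff_derivable; first exact: df.2.
exact: dg.2.
Qed.

End Sum.

Lemma cV_basis {R : realType} {m : nat} (w : 'cV[R]_m) :
  w = \sum_i w i ord0 *: delta_mx i ord0.
Proof.
rewrite [LHS]matrix_sum_delta; apply: eq_bigr => i _.
by rewrite big_ord1.
Qed.

Lemma differentiable_entry {R : realType} {V : normedModType R} {m p : nat}
    (h : V -> 'M[R]_(m, p)) (x : V) i j :
  differentiable h x -> differentiable (fun y => h y i j) x.
Proof.
move=> dh.
apply: (differentiable_comp (g := fun M : 'M[R]_(m, p) => M i j)) => //.
exact: differentiable_coord.
Qed.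

Section Composition.
Context {R : realType} {V : normedModType R} {m : nat}.
Context {F : V -> 'cV[R]_m} {e : 'cV[R]_m -> R}.
Hypothesis (dF : diff2 F) (de : diff2 e).

(** In the chain rule the direction ['D_v F z] moves with [z]; expanding it over fixed basis
    directions gives a sum of products that can be differentiated once more. *)
Lemma derive_comp_sum (v : V) : 'D_v (e \o F) =
  \sum_a (fun z => 'D_v F z a ord0) * ('D_(delta_mx a ord0) e \o F).
Proof.
apply/funext => z; rewrite derive_comp; [|exact: dF.1|exact: de.1].
rewrite [X in 'D_X e _]cV_basis derive_sumdir; last exact: de.1.
by rewrite fct_sumE.
Qed.

Let dterm v a (p : V) : differentiable
  ((fun z => 'D_v F z a ord0) * ('D_(delta_mx a ord0) e \o F)) p.
Proof.
apply: differentiableM; first by apply: differentiable_entry; exact: dF.2.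
by apply: differentiable_comp; [exact: dF.1|exact: de.2].
Qed.

Lemma diff2_comp : diff2 (e \o F).
Proof.
split=> [p|v p]; first by apply: differentiable_comp; [exact: dF.1|exact: de.1].
by rewrite derive_comp_sum; apply: differentiable_sum => a; exact: dterm.
Qed.

(** Product rule in each summand of [derive_comp_sum]: differentiating the outer factor gives the
    Hessian term, differentiating ['D_v F] the other one. *)
Lemma derive2_comp (v z : V) : 'D_v ('D_v (e \o F)) z =
  'D_('D_v F z) ('D_('D_v F z) e) (F z) + 'D_('D_v ('D_v F) z) e (F z).
Proof.
set w := 'D_v F z; set w' := 'D_v ('D_v F) z.
rewrite derive_comp_sum derive_sum; last first.
  by move=> a; apply: diff_derivable; exact: dterm.
(* Here [w] is frozen at its value at [z], so its coordinates are constants for the outer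
   derivative. *)
have -> : 'D_w e = \sum_a w a ord0 \*: 'D_(delta_mx a ord0) e.
  apply/funext => y; rewrite -[LHS]/('D_w e y) [X in 'D_X e _]cV_basis.
  rewrite derive_sumdir; last exact: de.1.
  by rewrite fct_sumE.
rewrite derive_sum; last first.
  by move=> a; apply/derivableZ/diff_derivable; exact: de.2.
rewrite [X in 'D_X e _]cV_basis derive_sumdir; last exact: de.1.
rewrite -big_split; apply: eq_bigr => a _ /=.
rewrite deriveM; last 2 first.
- by apply/diff_derivable/differentiable_entry; exact: dF.2.
- by apply/diff_derivable/differentiable_comp; [exact: dF.1|exact: de.2].
rewrite deriveZ; last by apply/diff_derivable; exact: de.2.
rewrite (derive_comp ('D_(delta_mx a ord0) e) F); [|exact: dF.1|exact: de.2].
congr (_ *: _ + _).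
rewrite /w' derive_mx; last by apply/diff_derivable; exact: dF.2.
by rewrite mxE; exact: mulrC.
Qed.

End Composition.

(** Symmetry merges the two mixed terms, matching [hess_block], whose lower left block is by
    definition a transpose. *)
Lemma derive2_addl {R : realType} {V : normedModType R} (h : V -> R)
    (v w z : V) : diff2 h ->
  'D_(v + w) ('D_(v + w) h) z =
  'D_v ('D_v h) z + 'D_w ('D_v h) z *+ 2 + 'D_w ('D_w h) z.
Proof.
move=> [dh dDh].
have -> : 'D_(v + w) h = 'D_v h + 'D_w h.
  by apply/funext => y; rewrite -[LHS]/('D_(v + w) h y) deriveDdir.
rewrite deriveDdir; last exact: differentiableD.
rewrite !deriveD; try by apply: diff_derivable; exact: dDh.
by rewrite (derive_sym h z w v)// mulr2n !addrA.
Qed.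

(** * Functions of two variables and their Hessian blocks *)

Lemma derive_pairl {R : realType} {U V W : normedModType R} (h : U * V -> W)
    (x v : U) (y : V) : 'D_v (fun x => h (x, y)) x = 'D_(v, 0) h (x, y).
Proof.
rewrite /derive; set f := (X in lim (X @ _)).
set g := (X in _ = lim (X @ _)); suff -> : f = g by [].
apply/funext => t; rewrite /f /g /=.
by rewrite -[t *: (v, 0) + (x, y)]/(t *: v + x, t *: 0 + y) scaler0 add0r.
Qed.

Lemma derive_pairr {R : realType} {U V W : normedModType R} (h : U * V -> W)
    (x : U) (y v : V) : 'D_v (fun y => h (x, y)) y = 'D_(0, v) h (x, y).
Proof.
rewrite /derive; set f := (X in lim (X @ _)).
set g := (X in _ = lim (X @ _)); suff -> : f = g by [].
apply/funext => t; rewrite /f /g /=.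
by rewrite -[t *: (0, v) + (x, y)]/(t *: 0 + x, t *: v + y) scaler0 add0r.
Qed.

Lemma diff2_fst {R : realType} {U V : normedModType R} : diff2 (@fst U V).
Proof. by apply: diff2_linear => p; exact: cvg_fst. Qed.

Lemma derive2_fst {R : realType} {U V : normedModType R} (z v : U * V) :
  'D_v ('D_v fst) z = 0.
Proof. by rewrite derive2_linear// => p; exact: cvg_fst. Qed.

Lemma diff2_pairl {R : realType} {U V W : normedModType R} (h : U * V -> W)
  (y : V) : diff2 h -> diff2 (fun x => h (x, y)).
Proof.
move=> [dh dDh].
have dpair x : differentiable (fun x : U => (x, y)) x.
  by apply: differentiable_pair => //; exact: differentiable_cst.
split=> [x|v x].
  by apply: (differentiable_comp (g := h) (f := fun x : U => (x, y))).
rewrite (_ : 'D_v _ = 'D_(v, 0) h \o (fun x : U => (x, y))).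
  exact: differentiable_comp.
by apply/funext => x'; exact: derive_pairl.
Qed.

(** Bilinearity of the iterated derivative in its two directions; two separate families let it serve
    diagonal and mixed blocks alike. *)
Lemma derive2_mx {R : realType} {V : normedModType R} (h : V -> R) {m p : nat}
    (d : 'I_m -> V) (d' : 'I_p -> V) (a : 'cV[R]_m) (a' : 'cV[R]_p) (z : V) :
  diff2 h ->
  (a^T *m (\matrix_(i, j) 'D_(d' j) ('D_(d i) h) z) *m a') ord0 ord0 =
  'D_(\sum_j a' j ord0 *: d' j) ('D_(\sum_i a i ord0 *: d i) h) z.
Proof.
move=> [dh dDh]; rewrite derive_sumdir; last exact: dDh.
rewrite mxE; apply: eq_bigr => j _; rewrite mxE mulrC; congr (_ * _).
have -> : 'D_(\sum_i a i ord0 *: d i) h = \sum_i a i ord0 \*: 'D_(d i) h.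
  apply/funext => y; rewrite -[LHS]/('D_(\sum_i a i ord0 *: d i) h y).
  by rewrite derive_sumdir// fct_sumE.
rewrite derive_sum => [|i]; last by apply/derivableZ/diff_derivable; exact: dDh.
apply: eq_bigr => i _; rewrite !mxE deriveZ//.
by apply: diff_derivable; exact: dDh.
Qed.

Lemma sum_pairl {R : realType} {U : lmodType R} {m : nat} (d : 'cV[R]_m) :
  \sum_i d i ord0 *: (delta_mx i ord0 : 'cV[R]_m, 0 : U) = (d, 0).
Proof.
rewrite [RHS]surjective_pairing [LHS]surjective_pairing !raddf_sum /=.
by rewrite -cV_basis [in X in (_, X)]big1 => [|i _]; rewrite ?scaler0.
Qed.

Lemma sum_pairr {R : realType} {U : lmodType R} {m : nat} (d : 'cV[R]_m) :
  \sum_i d i ord0 *: (0 : U, delta_mx i ord0 : 'cV[R]_m) = (0, d).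
Proof.
rewrite [RHS]surjective_pairing [LHS]surjective_pairing !raddf_sum /=.
by rewrite -cV_basis [in X in (X, _)]big1 => [|i _]; rewrite ?scaler0.
Qed.

(** Turns the quadratic forms of both second variations into second directional derivatives on the
    product space, where chain rules replace computations with blocks. *)
Lemma qform_hess_block {R : realType} {m p : nat}
    (h : 'cV[R]_m -> 'cV[R]_p -> R) x u dx du :
  let H := fun z : 'cV[R]_m * 'cV[R]_p => h z.1 z.2 in
  diff2 H ->
  qform (hess_block h x u) (col_mx dx du) = 'D_(dx, du) ('D_(dx, du) H) (x, u).
Proof.
move=> H dH.
have gradxE y w i : gradx h y w ord0 i = 'D_(delta_mx i ord0, 0) H (y, w).
  by rewrite mxE -derive_pairl.
have graduE y w i : gradu h y w ord0 i = 'D_(0, delta_mx i ord0) H (y, w).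
  by rewrite mxE -derive_pairr.
have xxE : hessxx h x u = \matrix_(i, j)
    'D_(delta_mx j ord0, 0) ('D_(delta_mx i ord0, 0) H) (x, u).
  apply/matrixP => i j; rewrite !mxE -derive_pairl.
  by congr ('D__ _ _); apply/funext => y; rewrite mxE gradxE.
have xuE : hessxu h x u = \matrix_(i, j)
    'D_(0, delta_mx j ord0) ('D_(delta_mx i ord0, 0) H) (x, u).
  apply/matrixP => i j; rewrite !mxE -derive_pairr.
  by congr ('D__ _ _); apply/funext => y; rewrite mxE gradxE.
have uuE : hessuu h x u = \matrix_(i, j)
    'D_(0, delta_mx j ord0) ('D_(0, delta_mx i ord0) H) (x, u).
  apply/matrixP => i j; rewrite !mxE -derive_pairr.
  by congr ('D__ _ _); apply/funext => y; rewrite mxE graduE.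
have addE (M N : 'M[R]_1) : (M + N) ord0 ord0 = M ord0 ord0 + N ord0 ord0.
  by rewrite mxE.
have trE (Q : 'M[R]_(m, p)) :
    (du^T *m Q^T *m dx) ord0 ord0 = (dx^T *m Q *m du) ord0 ord0.
  transitivity ((du^T *m Q^T *m dx)^T ord0 ord0); first by rewrite [RHS]mxE.
  by rewrite !trmx_mul !trmxK mulmxA.
rewrite /qform /hess_block tr_col_mx mul_row_block mul_row_col !mulmxDl !addE.
rewrite trE xxE xuE uuE !derive2_mx// !sum_pairl !sum_pairr.
have -> : (dx, du) = (dx, 0) + (0, du) :> 'cV[R]_m * 'cV[R]_p.
  by rewrite -[RHS]/(dx + 0, 0 + du) addr0 add0r.
apply: etrans (esym (derive2_addl H (dx, 0) (0, du) (x, u) dH)).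
by rewrite mulr2n !addrA.
Qed.

(** * Gradients, Jacobians and linear forms *)

Section FirstOrder.
Context {R : realType} {m p : nat}.
Implicit Types (x v : 'cV[R]_m) (g : 'cV[R]_m -> R) (h : 'cV[R]_m -> 'cV[R]_p).

Lemma grad_derive g x v : differentiable g x ->
  (grad g x *m v) ord0 ord0 = 'D_v g x.
Proof.
move=> dg; rewrite [X in _ = 'D_X g x]cV_basis derive_sumdir// mxE.
by apply: eq_bigr => i _; rewrite mxE mulrC.
Qed.

Lemma jac_derive h x v : differentiable h x -> jac h x *m v = 'D_v h x.
Proof.
move=> dh; rewrite [X in _ = 'D_X h x]cV_basis derive_sumdir//.
apply/matrixP => i j; rewrite ord1 mxE summxE; apply: eq_bigr => a _.
rewrite [in RHS]derive_mx; last exact: diff_derivable.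
by rewrite !mxE mulrC.
Qed.

Lemma jac_delta h x j : differentiable h x ->
  'D_(delta_mx j ord0) h x = col j (jac h x).
Proof. by move=> dh; rewrite -jac_derive// colE. Qed.

Lemma gradD g g' x : differentiable g x -> differentiable g' x ->
  grad (g + g') x = grad g x + grad g' x.
Proof.
move=> dg dg'; apply/rowP => j; rewrite !mxE.
exact: deriveD (diff_derivable dg) (diff_derivable dg').
Qed.

Lemma eq_mulmx_cV (A B : 'M[R]_(p, m)) :
  (forall v : 'cV[R]_m, A *m v = B *m v) -> A = B.
Proof.
move=> AB; apply/matrixP => i j.
by have := AB (delta_mx j ord0); rewrite -!colE => /colP/(_ i); rewrite !mxE.
Qed.

Lemma jacD h h' x : differentiable h x -> differentiable h' x ->
  jac (h + h') x = jac h x + jac h' x.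
Proof.
move=> dh dh'; apply: eq_mulmx_cV => v.
rewrite mulmxDl (jac_derive _ _ _ dh) (jac_derive _ _ _ dh').
rewrite (jac_derive _ _ _ (differentiableD dh dh')).
by rewrite (deriveD (diff_derivable dh) (diff_derivable dh')).
Qed.

Lemma jac_cst (a : 'cV[R]_p) x : jac (fun=> a) x = 0.
Proof. by apply/matrixP => i j; rewrite !mxE (derive_cst (a i ord0)). Qed.

Lemma grad_cst (a : R) x : grad (fun=> a) x = 0.
Proof. by apply/rowP => j; rewrite !mxE (derive_cst a). Qed.

End FirstOrder.

Lemma jac_id {R : realType} {m : nat} (x : 'cV[R]_m) : jac id x = 1%:M.
Proof. by apply: eq_mulmx_cV => v; rewrite jac_derive// derive_id mul1mx. Qed.

Lemma grad_comp {R : realType} {m p : nat} (g : 'cV[R]_p -> R)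
    (h : 'cV[R]_m -> 'cV[R]_p) (x : 'cV[R]_m) :
  differentiable h x -> differentiable g (h x) ->
  grad (g \o h) x = grad g (h x) *m jac h x.
Proof.
move=> dh dg; apply/rowP => j; rewrite [LHS]mxE (derive_comp _ _ _ _ dh dg).
rewrite -(grad_derive _ _ _ dg) (jac_delta _ _ _ dh) !mxE.
by apply: eq_bigr => i _; rewrite !mxE.
Qed.

Lemma jac_comp {R : realType} {m p r : nat} (g : 'cV[R]_p -> 'cV[R]_r)
    (h : 'cV[R]_m -> 'cV[R]_p) (x : 'cV[R]_m) :
  differentiable h x -> differentiable g (h x) ->
  jac (g \o h) x = jac g (h x) *m jac h x.
Proof.
move=> dh dg; apply: eq_mulmx_cV => v.
rewrite -mulmxA (jac_derive _ _ _ dh) (jac_derive _ _ _ dg).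
rewrite (jac_derive _ _ _ (differentiable_comp dh dg)).
exact: derive_comp.
Qed.

(** Pairing with a multiplier as a function of its second argument, so that lambda^T f and mu^T phi
    become compositions with a linear map. *)
Definition mx_form {R : realType} {m : nat} (a : 'cV[R]_m) (y : 'cV[R]_m) : R :=
  (a^T *m y) ord0 ord0.

Lemma mx_formE {R : realType} {m : nat} (a : 'cV[R]_m) :
  mx_form a = \sum_i a i ord0 \*: (fun y : 'cV[R]_m => y i ord0).
Proof.
apply/funext => y; rewrite fct_sumE /mx_form mxE.
by apply: eq_bigr => i _; rewrite mxE.
Qed.

Lemma mx_form_is_linear {R : realType} {m : nat} (a : 'cV[R]_m) :
  linear (mx_form a : 'cV[R]_m -> R^o).
Proof. by move=> k y z; rewrite /mx_form mulmxDr -scalemxAr !mxE. Qed.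

HB.instance Definition _ {R : realType} {m : nat} (a : 'cV[R]_m) :=
  GRing.isLinear.Build R 'cV[R]_m R^o _ (mx_form a) (mx_form_is_linear a).

Lemma continuous_mx_form {R : realType} {m : nat} (a : 'cV[R]_m) :
  continuous (mx_form a).
Proof.
move=> y; apply: differentiable_continuous; rewrite mx_formE.
by apply: differentiable_sum => i; exact/differentiableZ/differentiable_coord.
Qed.

Lemma diff2_mx_form {R : realType} {m : nat} (a : 'cV[R]_m) : diff2 (mx_form a).
Proof. exact: diff2_linear (@continuous_mx_form R m a). Qed.

Lemma derive_mx_form {R : realType} {m : nat} (a y v : 'cV[R]_m) :
  'D_v (mx_form a) y = mx_form a v.
Proof. exact: derive_linear (@continuous_mx_form R m a). Qed.

Lemma derive2_mx_form {R : realType} {m : nat} (a y v : 'cV[R]_m) :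
  'D_v ('D_v (mx_form a)) y = 0.
Proof. exact: derive2_linear (@continuous_mx_form R m a). Qed.

Lemma grad_mx_form {R : realType} {m : nat} (a y : 'cV[R]_m) :
  grad (mx_form a) y = a^T.
Proof.
by apply/rowP => j; rewrite mxE derive_mx_form /mx_form -colE !mxE.
Qed.

Lemma derive2_mx_form_comp {R : realType} {V : normedModType R} {m : nat}
    (a : 'cV[R]_m) (F : V -> 'cV[R]_m) (z v : V) : diff2 F ->
  'D_v ('D_v (mx_form a \o F)) z = mx_form a ('D_v ('D_v F) z).
Proof.
move=> dF; rewrite (derive2_comp dF (diff2_mx_form a)).
by rewrite derive2_mx_form add0r derive_mx_form.
Qed.

Lemma differentiable_pairl {R : realType} {U V W : normedModType R}
    (h : U * V -> W) (x : U) (y : V) :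
  differentiable h (x, y) -> differentiable (fun x => h (x, y)) x.
Proof.
by move=> dh; apply: (differentiable_comp (g := h) (f := fun x : U => (x, y))).
Qed.

Lemma differentiable_pairr {R : realType} {U V W : normedModType R}
    (h : U * V -> W) (x : U) (y : V) :
  differentiable h (x, y) -> differentiable (fun y => h (x, y)) y.
Proof.
by move=> dh; apply: (differentiable_comp (g := h) (f := fun y : V => (x, y))).
Qed.

Lemma differentiable_col {R : realType} {V : normedModType R} {m : nat}
    (h : V -> 'cV[R]_m) (x : V) :
  (forall i, differentiable (fun y => h y i ord0) x) -> differentiable h x.
Proof.
move=> dh.
rewrite (_ : h = \sum_i (fun y => h y i ord0 *: (delta_mx i ord0 : 'cV[R]_m))).
  by apply: differentiable_sum => i; exact: differentiableZl.
by apply/funext => y; rewrite fct_sumE [LHS]cV_basis.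
Qed.

(** * Derivatives of the Hamiltonians and of one step of the dynamics *)

Section Stage.
Context {R : realType} {n nu : nat}.
Local Notation X := 'cV[R]_(n + n).
Local Notation U := 'cV[R]_nu.
Context {L : X -> U -> R} {f : X -> U -> X}.
Let Lz (z : X * U) := L z.1 z.2.
Let fz (z : X * U) := f z.1 z.2.
Hypotheses (dL : diff2 Lz) (df : diff2 fz).
Implicit Types (x dx lam : X) (u du : U) (d : 'rV[R]_(n + n)).

(** The vector through which a change of multiplier enters the second variation; [next f] has the
    same second derivative, since it differs from [f] by a linear map. *)
Definition D2f x u dx du : X := 'D_(dx, du) ('D_(dx, du) fz) (x, u).

Lemma gradx_Ham lam x u :
  gradx (fun y w => Ham L f y w lam) x u = gradx L x u + lam^T *m jacx f x u.
Proof.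
have dLx : differentiable (fun y => L y u) x.
  exact: (differentiable_pairl Lz x u (dL.1 _)).
have dfx : differentiable (fun y => f y u) x.
  exact: (differentiable_pairl fz x u (df.1 _)).
have dl := (diff2_mx_form lam).1 (f x u).
rewrite -(grad_mx_form lam (f x u)) -(grad_comp _ _ _ dfx dl).
exact: gradD dLx (differentiable_comp dfx dl).
Qed.

Lemma gradu_Ham lam x u :
  gradu (fun y w => Ham L f y w lam) x u = gradu L x u + lam^T *m jacu f x u.
Proof.
have dLu : differentiable (L x) u.
  exact: (differentiable_pairr Lz x u (dL.1 _)).
have dfu : differentiable (f x) u.
  exact: (differentiable_pairr fz x u (df.1 _)).
have dl := (diff2_mx_form lam).1 (f x u).
rewrite -(grad_mx_form lam (f x u)) -(grad_comp _ _ _ dfu dl).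
exact: gradD dLu (differentiable_comp dfu dl).
Qed.

Lemma diff2_Ham lam : diff2 (fun z : X * U => Ham L f z.1 z.2 lam).
Proof. exact: diff2D dL (diff2_comp df (diff2_mx_form lam)). Qed.

Lemma qform_Ham lam x u dx du :
  qform (hess_block (fun y w => Ham L f y w lam) x u) (col_mx dx du) =
  'D_(dx, du) ('D_(dx, du) (fun z : X * U => Ham L f z.1 z.2 lam)) (x, u).
Proof.
exact: (qform_hess_block (fun y w => Ham L f y w lam) x u dx du
  (diff2_Ham lam)).
Qed.

(** [Ham] is affine in the multiplier, so the shift adds exactly the second derivative of d f. *)
Lemma qform_Ham_shift lam l d x u dx du : l = lam + d^T ->
  qform (hess_block (fun y w => Ham L f y w l) x u) (col_mx dx du) =
  qform (hess_block (fun y w => Ham L f y w lam) x u) (col_mx dx du)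
  + (d *m D2f x u dx du) ord0 ord0.
Proof.
move=> El; apply: etrans (qform_Ham l x u dx du) _.
apply: etrans _ (congr1 (+%R^~ _) (esym (qform_Ham lam x u dx du))).
have HamD : (fun z : X * U => Ham L f z.1 z.2 l) =
    (fun z : X * U => Ham L f z.1 z.2 lam) + (mx_form d^T \o fz).
  by apply/funext => z; rewrite El /Ham linearD mulmxDl mxE addrA.
have dd := diff2_comp df (diff2_mx_form d^T).
rewrite HamD; apply: etrans (derive2D (diff2_Ham lam) dd (dx, du) (x, u)) _.
congr (_ + _); apply: etrans (derive2_mx_form_comp d^T fz (x, u) (dx, du) df) _.
by rewrite /mx_form trmxK.
Qed.

Lemma diff2_next : diff2 (fun z : X * U => next f z.1 z.2).
Proof. exact: diff2D diff2_fst df. Qed.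

Lemma jacx_next x u : jac (fun y => next f y u) x = 1%:M + jacx f x u.
Proof.
have dfx : differentiable (fun y => f y u) x.
  exact: (differentiable_pairl fz x u (df.1 _)).
by rewrite -(jac_id x); apply: (jacD _ _ _ _ dfx).
Qed.

Lemma jacu_next x u : jac (next f x) u = jacu f x u.
Proof.
have dfu : differentiable (f x) u.
  exact: (differentiable_pairr fz x u (df.1 _)).
rewrite -[RHS]add0r -(jac_cst x u); apply: (jacD _ _ _ _ dfu).
exact: differentiable_cst.
Qed.

Lemma differentiable_nextx x u : differentiable (fun y => next f y u) x.
Proof.
exact: (differentiable_pairl (fun z => next f z.1 z.2) x u (diff2_next.1 _)).
Qed.

Lemma differentiable_nextu x u : differentiable (next f x) u.
Proof.
exact: (differentiable_pairr (fun z => next f z.1 z.2) x u (diff2_next.1 _)).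
Qed.

Lemma derive_next x u dx du :
  'D_(dx, du) (fun z : X * U => next f z.1 z.2) (x, u) =
  (1%:M + jacx f x u) *m dx + jacu f x u *m du.
Proof.
have -> : (dx, du) = (dx, 0) + (0, du) :> X * U.
  by rewrite -[RHS]/(dx + 0, 0 + du) addr0 add0r.
rewrite (deriveDdir _ _ _ _ (diff2_next.1 (x, u))) -derive_pairl -derive_pairr.
rewrite -jacx_next -jacu_next; congr (_ + _); apply: esym; apply: jac_derive.
  exact: differentiable_nextx.
exact: differentiable_nextu.
Qed.

Lemma derive2_next x u dx du :
  'D_(dx, du) ('D_(dx, du) (fun z : X * U => next f z.1 z.2)) (x, u) =
  D2f x u dx du.
Proof.
apply: etrans (derive2D diff2_fst df (dx, du) (x, u)) _.
by rewrite derive2_fst add0r.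
Qed.

(** Along solutions of the linearised dynamics, [w] is the variation of the next state. *)
Lemma derive2_comp_next (c : X -> R) x u dx du : diff2 c ->
  let w := (1%:M + jacx f x u) *m dx + jacu f x u *m du in
  'D_(dx, du) ('D_(dx, du) (fun z : X * U => c (next f z.1 z.2))) (x, u) =
  'D_w ('D_w c) (next f x u)
  + (grad c (next f x u) *m D2f x u dx du) ord0 ord0.
Proof.
move=> dc w; apply: etrans (derive2_comp diff2_next dc (dx, du) (x, u)) _.
by rewrite derive_next derive2_next (grad_derive _ _ _ (dc.1 _)).
Qed.

Section Constraint.
Context {c : X -> R}.
Hypothesis dc : diff2 c.

Lemma grad_comp_nextx x u : grad (fun y => c (next f y u)) x =
  grad c (next f x u) *m (1%:M + jacx f x u).
Proof.
rewrite -jacx_next; apply: (grad_comp c (fun y => next f y u) x).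
  exact: differentiable_nextx.
exact: dc.1.
Qed.

Lemma grad_comp_nextu x u :
  grad (fun w => c (next f x w)) u = grad c (next f x u) *m jacu f x u.
Proof.
rewrite -jacu_next; apply: (grad_comp c (next f x) u).
  exact: differentiable_nextu.
exact: dc.1.
Qed.

Context {nc : nat} {fq : X -> 'cV[R]_n} {phi : X -> 'cV[R]_nc} {mu : 'cV[R]_nc}.
Hypothesis cE : forall y w, mx_form mu (phi (next2 f fq y w)) = c (next f y w).

(** By [cE] the added constraint term depends on state and control only through [next f], so a
    single composition is differentiated instead of the nested two-step map. *)
Lemma HamtE lam : (fun z : X * U => Hamt L f fq phi z.1 z.2 lam mu) =
  (fun z => Ham L f z.1 z.2 lam) + (fun z => c (next f z.1 z.2)).
Proof. by apply/funext => z; rewrite /Hamt -[X in _ + X]/(mx_form _ _) cE. Qed.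

Lemma diff2_comp_next : diff2 (fun z : X * U => c (next f z.1 z.2)).
Proof. exact: diff2_comp diff2_next dc. Qed.

Lemma gradx_Hamt lam x u :
  gradx (fun y w => Hamt L f fq phi y w lam mu) x u =
  gradx (fun y w => Ham L f y w lam) x u
  + grad c (next f x u) *m (1%:M + jacx f x u).
Proof.
rewrite -grad_comp_nextx.
have E : (fun y => Hamt L f fq phi y u lam mu) =
    (fun y => Ham L f y u lam) + (fun y => c (next f y u)).
  by apply/funext => y; exact: (congr1 (fun h => h (y, u)) (HamtE lam)).
apply: etrans (congr1 (fun h => grad h x) E) _; apply: gradD.
  exact: (differentiable_pairl (fun z => Ham L f z.1 z.2 lam) x u
    ((diff2_Ham lam).1 _)).
exact: (differentiable_pairl (fun z => c (next f z.1 z.2)) x u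
  (diff2_comp_next.1 _)).
Qed.

Lemma gradu_Hamt lam x u :
  gradu (fun y w => Hamt L f fq phi y w lam mu) x u =
  gradu (fun y w => Ham L f y w lam) x u + grad c (next f x u) *m jacu f x u.
Proof.
rewrite -grad_comp_nextu.
have E : (fun w => Hamt L f fq phi x w lam mu) =
    (fun w => Ham L f x w lam) + (fun w => c (next f x w)).
  by apply/funext => w; exact: (congr1 (fun h => h (x, w)) (HamtE lam)).
apply: etrans (congr1 (fun h => grad h u) E) _; apply: gradD.
  exact: (differentiable_pairr (fun z => Ham L f z.1 z.2 lam) x u
    ((diff2_Ham lam).1 _)).
exact: (differentiable_pairr (fun z => c (next f z.1 z.2)) x u
  (diff2_comp_next.1 _)).
Qed.

Lemma qform_Hamt lam x u dx du :
  let w := (1%:M + jacx f x u) *m dx + jacu f x u *m du in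
  qform (hess_block (fun y w => Hamt L f fq phi y w lam mu) x u)
    (col_mx dx du) =
  qform (hess_block (fun y w => Ham L f y w lam) x u) (col_mx dx du)
  + ('D_w ('D_w c) (next f x u)
     + (grad c (next f x u) *m D2f x u dx du) ord0 ord0).
Proof.
have dHt : diff2 (fun z : X * U => Hamt L f fq phi z.1 z.2 lam mu).
  by rewrite HamtE; exact: diff2D (diff2_Ham lam) diff2_comp_next.
move=> w; apply: etrans (qform_hess_block
  (fun y w => Hamt L f fq phi y w lam mu) x u dx du dHt) _.
rewrite HamtE.
apply: etrans _ (congr1 (+%R^~ _) (esym (qform_Ham lam x u dx du))).
apply: etrans (derive2D (diff2_Ham lam) diff2_comp_next (dx, du) (x, u)) _.
exact: congr1 (derive2_comp_next c x u dx du dc).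
Qed.

End Constraint.

Lemma qform_Hamc {nc : nat} (phi : X -> 'cV[R]_nc) (mu : 'cV[R]_nc)
    lam x u dx du : diff2 (mx_form mu \o phi) ->
  qform (hess_block (fun y w => Hamc L f phi y w lam mu) x u) (col_mx dx du) =
  qform (hess_block (fun y w => Ham L f y w lam) x u) (col_mx dx du)
  + 'D_dx ('D_dx (mx_form mu \o phi)) x.
Proof.
move=> de.
have de1 := diff2_comp (@diff2_fst R X U) de.
have dHc : diff2 (fun z : X * U => Hamc L f phi z.1 z.2 lam mu).
  exact: diff2D (diff2_Ham lam) de1.
apply: etrans (qform_hess_block
  (fun y w => Hamc L f phi y w lam mu) x u dx du dHc) _.
apply: etrans _ (congr1 (+%R^~ _) (esym (qform_Ham lam x u dx du))).
apply: etrans (derive2D (diff2_Ham lam) de1 (dx, du) (x, u)) _.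
(* The derivative of [h \o fst] along [(dx, du)] is convertible to that of [h]
   along [dx]. *)
by [].
Qed.

(** One function is differentiated in two ways: as [c] after the first projection and as [e] after
    [next f]. This yields the balance at stage k-1. *)
Lemma derive2_factor (e c : X -> R) x u dx du : diff2 e -> diff2 c ->
  (forall y w, e (next f y w) = c y) ->
  let w := (1%:M + jacx f x u) *m dx + jacu f x u *m du in
  'D_dx ('D_dx c) x = 'D_w ('D_w e) (next f x u)
    + (grad e (next f x u) *m D2f x u dx du) ord0 ord0.
Proof.
move=> de dc ec w; apply: etrans (derive2_comp_next e x u dx du de).
have -> : (fun z : X * U => e (next f z.1 z.2)) = c \o fst.
  by apply/funext => z; rewrite ec.
by [].
Qed.

End Stage.

Lemma diff2_mx_form_comp {R : realType} {V : normedModType R} {m : nat}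
    (a : 'cV[R]_m) (h : V -> 'cV[R]_m) : diff2 h -> diff2 (mx_form a \o h).
Proof. by move=> dh; exact: diff2_comp dh (diff2_mx_form a). Qed.

(** Spreads a term belonging to one stage over the whole sum, so that sums can be compared stage by
    stage. *)
Lemma sum_at {R : realType} (N K : nat) (r : R) : (K < N)%N ->
  \sum_(i < N) (if i == K :> nat then r else 0) = r.
Proof. by move=> KN; rewrite -big_mkcond (big_pred1 (Ordinal KN)). Qed.

(** * The constraint function one step ahead *)

Section TwoSteps.
Context {R : realType} {n nu nc : nat}.
Context {f : 'cV[R]_(n + n) -> 'cV[R]_nu -> 'cV[R]_(n + n)}.
Context {fq : 'cV[R]_(n + n) -> 'cV[R]_n}.
Context {fv : 'cV[R]_(n + n) -> 'cV[R]_nu -> 'cV[R]_n}.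
Context {phi : 'cV[R]_(n + n) -> 'cV[R]_nc}.
Hypothesis df : diff2 (fun z : 'cV[R]_(n + n) * 'cV[R]_nu => f z.1 z.2).
Hypothesis dphi : forall x, differentiable phi x.
Hypothesis f_form : forall x u, f x u = col_mx (fq x) (fv x u).
Hypothesis phi_q : forall x y, usubmx x = usubmx y -> phi x = phi y.

(** Both arguments have upper block [usubmx y + fq y]; the control enters only the velocity. *)
Lemma phi_next y w : phi (y + gmap fq y) = phi (next f y w).
Proof.
by apply: phi_q; rewrite /next f_form /gmap !linearD /= !col_mxKu.
Qed.

(** [fq] inherits differentiability from [f], being its upper block at control 0. *)
Lemma differentiable_gmap y : differentiable (gmap fq) y.
Proof.
have df0 : differentiable (fun y => f y 0) y.
  exact: (differentiable_pairl (fun z => f z.1 z.2) y 0 (df.1 _)).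
apply: differentiable_col => i; case: (split_ordP i) => j ->.
  rewrite (_ : (fun y => _) = (fun y => f y 0 (lshift n j) ord0)).
    exact: differentiable_entry.
  by apply/funext => z; rewrite f_form /gmap !col_mxEu.
rewrite (_ : (fun y => _) = cst 0); first exact: differentiable_cst.
by apply/funext => z; rewrite /gmap col_mxEd mxE.
Qed.

(** Obtained by differentiating [phi_next] in [y] at fixed [w]. *)
Lemma jac_phi_next y w :
  jac phi (y + gmap fq y) *m (1%:M + jac (gmap fq) y) =
  jac phi (next f y w) *m (1%:M + jacx f y w).
Proof.
have dg := differentiable_gmap y.
have di : differentiable (id : 'cV[R]_(n + n) -> _) y by [].
rewrite -(jacx_next df) -(jac_id y) -(jacD _ _ _ di dg).
rewrite -(jac_comp phi (id + gmap fq) y (differentiableD di dg) (dphi _)).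
rewrite -(jac_comp phi (fun y => next f y w) y
  (differentiable_nextx df _ _) (dphi _)).
have E : phi \o (id + gmap fq) = phi \o (fun y => next f y w).
  by apply/funext => z; exact: phi_next.
exact: (congr1 (fun h => jac h y) E).
Qed.

(** By [phi_next], [phi \o next f y] is constant in the control. *)
Lemma jac_phi_jacu y w : jac phi (next f y w) *m jacu f y w = 0.
Proof.
rewrite -(jacu_next df).
rewrite -(jac_comp phi (next f y) w (differentiable_nextu df _ _) (dphi _)).
rewrite -(jac_cst (phi (y + gmap fq y)) w).
have E : phi \o next f y = (fun=> phi (y + gmap fq y)).
  by apply/funext => z; rewrite /= -phi_next.
exact: (congr1 (fun h => jac h w) E).
Qed.

End TwoSteps.

Theorem theorem4p2 (R : realType) (n nu nc N k : nat)
  (hn : (0 < n)%N) (hnu : (0 < nu <= n)%N) (hnc : (0 < nc <= n)%N)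
  (hN : (0 < N)%N) (hk : (2 <= k <= N - 1)%N)
  (varphi : 'cV[R]_(n + n) -> R)
  (L : 'cV[R]_(n + n) -> 'cV[R]_nu -> R)
  (f : 'cV[R]_(n + n) -> 'cV[R]_nu -> 'cV[R]_(n + n))
  (fq : 'cV[R]_(n + n) -> 'cV[R]_n)
  (fv : 'cV[R]_(n + n) -> 'cV[R]_nu -> 'cV[R]_n)
  (phi : 'cV[R]_(n + n) -> 'cV[R]_nc)
  (xbar : 'cV[R]_(n + n))
  (varphi_C2 : C2 varphi)
  (L_C2 : C2 (fun z : 'cV[R]_(n + n) * 'cV[R]_nu => L z.1 z.2))
  (f_C2 : C2 (fun z : 'cV[R]_(n + n) * 'cV[R]_nu => f z.1 z.2))
  (phi_C2 : C2 phi)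
  (f_form : forall x u, f x u = col_mx (fq x) (fv x u))
  (phi_q : forall x y, usubmx x = usubmx y -> phi x = phi y)
  (x : nat -> 'cV[R]_(n + n)) (u : nat -> 'cV[R]_nu)
  (lam : nat -> 'cV[R]_(n + n)) (mu : 'cV[R]_nc) :
  sosc_transformed N k varphi L f fq phi xbar x u lam mu ->
  exists (lam_s : nat -> 'cV[R]_(n + n)) (mu_s : 'cV[R]_nc),
    sosc_original N k varphi L f phi xbar x u lam_s mu_s.
Proof.
have dL := C2_diff2 _ L_C2; have df := C2_diff2 _ f_C2.
have dphi := C2_diff2 _ phi_C2.
(* With k = K + 2 the special stage k-2 is [K] and the truncated subtractions disappear. *)
case: k hk => [|[|K]]// hk.
have K2N : (K.+2 < N)%N by case: N hN hk => // N' _; rewrite subn1 ltnS.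
have K1N : (K.+1 < N)%N by exact: ltn_trans K2N.
have K0N : (K < N)%N by exact: ltn_trans K1N.
rewrite /sosc_transformed /fonc_transformed !subSS !subn0.
move=> [[[dynx x0] phi0 lamN stat [statx statu]] pos].
have xS i : (i < N)%N -> next f (x i) (u i) = x i.+1.
  by move=> /dynx /eqP; rewrite subr_eq0 => /eqP.
pose e := mx_form mu \o phi.
(* The control [u K.+1] is an arbitrary choice: by [ec] any other gives the same function. *)
pose c y := e (next f y (u K.+1)).
have de : diff2 e by exact: diff2_mx_form_comp.
have dnextl : diff2 (fun y => next f y (u K.+1)).
  exact: (diff2_pairl (fun z => next f z.1 z.2) (u K.+1) (diff2_next df)).
have dc : diff2 c by exact: diff2_comp dnextl de.
have ec y w : e (next f y w) = c y.
  by rewrite /c /e /= -!(phi_next f_form phi_q).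
have cE y w : mx_form mu (phi (next2 f fq y w)) = c (next f y w).
  by rewrite -(ec _ 0) /e /= /next2 (phi_next f_form phi_q _ 0).
pose ge := grad e (x K.+2); pose gc := grad c (x K.+1).
have geE : ge = mu^T *m jac phi (x K.+2).
  rewrite -(grad_mx_form mu (phi (x K.+2))).
  exact: grad_comp (dphi.1 _) ((diff2_mx_form mu).1 _).
(* By the chain rule [gc] is [ge] carried one stage back by the adjoint recursion. *)
have gcE : gc = ge *m (1%:M + jacx f (x K.+1) (u K.+1)).
  by rewrite /ge -(xS K.+1 K1N) -(grad_comp_nextx df de).
have ge_jacu : ge *m jacu f (x K.+1) (u K.+1) = 0.
  rewrite /ge -(xS K.+1 K1N) -(grad_comp_nextu df de).
  rewrite -(grad_cst (c (x K.+1)) (u K.+1)).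
  have E : (fun w => e (next f (x K.+1) w)) = (fun=> c (x K.+1)).
    by apply/funext => w; exact: ec.
  exact: (congr1 (fun h => grad h (u K.+1)) E).
(* The corrections are rows, like gradients; [lam_s] adds their transposes. *)
pose d i := if i == K.+1 then gc else if i == K.+2 then ge else 0.
pose lam_s i := lam i + (d i)^T.
have d1 : d K.+1 = gc by rewrite /d eqxx.
have d2 : d K.+2 = ge by rewrite /d eqxx gtn_eqF.
have d0 i : i <> K.+1 -> i <> K.+2 -> d i = 0.
  by move=> /eqP/negbTE i1 /eqP/negbTE i2; rewrite /d i1 i2.
have gradxE i y w : gradx (fun y w => Ham L f y w (lam_s i)) y w =
    gradx (fun y w => Ham L f y w (lam i)) y w + d i *m jacx f y w.
  by rewrite !(gradx_Ham dL df) /lam_s linearD /= trmxK mulmxDl addrA.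
have graduE i y w : gradu (fun y w => Ham L f y w (lam_s i)) y w =
    gradu (fun y w => Ham L f y w (lam i)) y w + d i *m jacu f y w.
  by rewrite !(gradu_Ham dL df) /lam_s linearD /= trmxK mulmxDl addrA.
have linS (dx : nat -> 'cV[R]_(n + n)) (du : nat -> 'cV[R]_nu) i :
    lin_dynamics N f x u dx du -> (i < N)%N ->
    (1%:M + jacx f (x i) (u i)) *m dx i + jacu f (x i) (u i) *m du i = dx i.+1.
  by move=> [_ lin] /lin /eqP; rewrite subr_eq0 => /eqP.
have dK : d K = 0 by apply: d0 => /eqP; rewrite ltn_eqF// ltnW.
have dK3 : d K.+3 = 0 by apply: d0 => /eqP; rewrite gtn_eqF.
exists lam_s, mu; split.

  (* First-order conditions of the original problem *)
  split.
  - by split.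
  - by rewrite -(xS K.+1)// -(phi_next f_form phi_q) -(xS K).
  (* Since k < N, the terminal multiplier receives no correction. *)
  - rewrite /lam_s (d0 N) ?trmx0 ?addr0//.
      by move=> NK; rewrite NK ltnn in K1N.
    by move=> NK; rewrite NK ltnn in K2N.
  - move=> i iN iK2; rewrite gradxE /lam_s.
    (* Stage k-2: of the extra term [gc] (I + f_x), the part [gc] f_x comes from the Hamiltonian
       with shifted multiplier and [gc] from lambda_(k-1) itself. *)
    have [->|iK] := eqVneq i K.
      rewrite d1 dK trmx0 addr0 -[RHS]statx (gradx_Hamt dL df dc cE) xS//.
      rewrite -/gc mulmxDr mulmx1 !linearD /=; congr (_ - _).
      by rewrite -!addrA; congr (_ + _); rewrite [RHS]addrC -addrA.
    (* Stage k-1: by [gcE] the new terms [ge] f_x + [ge] - [gc] cancel. *)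
    have [->|iK1] := eqVneq i K.+1.
      have [st _] := stat K.+1 K1N ltac:(by apply/eqP; rewrite gtn_eqF).
      rewrite d1 d2 gcE mulmxDr mulmx1 !linearD /= -[RHS]st.
      rewrite [X in X + _ = _]addrACA [LHS]addrACA [X in _ + X = _]addrA addrK.
      by rewrite subrr addr0.
    have [st _] := stat i iN ltac:(by apply/eqP).
    have di : d i = 0 by apply: d0 => //; exact/eqP.
    have diS : d i.+1 = 0 by apply: d0 => -[]; exact/eqP.
    by rewrite di diS mul0mx trmx0 !addr0.
  - split.
      (* Stage k: by [geE] the constraint term phi_x^T mu is the transpose of [ge] and cancels the
         correction of lambda_k. *)
      have [st _] := stat K.+2 K2N ltac:(by apply/eqP; rewrite gtn_eqF// ltnW).
      rewrite gradxE /lam_s dK3 d2 mul0mx trmx0 !addr0 -[RHS]st.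
      rewrite geE trmx_mul trmxK (addrAC _ _ (lam K.+3)) opprD addrACA.
      by rewrite subrr addr0.
    (* In the control, [gc] f_u is exactly the extra term at k-2, and [ge_jacu] removes the
       correction at k-1. *)
    move=> i iN; rewrite graduE.
    have [->|iK] := eqVneq i K.
      by rewrite d1 -[RHS]statu (gradu_Hamt dL df dc cE) xS.
    have [_ st] := stat i iN ltac:(by apply/eqP).
    have [i1|iK1] := eqVneq i K.+1.
      by rewrite i1 d2 ge_jacu addr0 -i1.
    have diS : d i.+1 = 0 by apply: d0 => -[]; exact/eqP.
    by rewrite diS mul0mx addr0.

(* Positivity of the second variation *)
move=> dx du nz lin tan.
have posT := pos dx du nz lin.
(* Common baseline of both sums: the stage terms with uncorrected multipliers. *)
pose A i := qform (hess_block (fun y w => Ham L f y w (lam i.+1)) (x i) (u i))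
  (col_mx (dx i) (du i)).
(* [X1] and [X2] are what shifting lambda_(k-1) and lambda_k adds to stages k-2 and k-1; [C] and [E]
   are the second derivatives of [c] and [e] along the variation. *)
pose X1 := (gc *m D2f (f := f) (x K) (u K) (dx K) (du K)) ord0 ord0.
pose X2 := (ge *m D2f (f := f) (x K.+1) (u K.+1) (dx K.+1) (du K.+1)) ord0 ord0.
pose C := 'D_(dx K.+1) ('D_(dx K.+1) c) (x K.+1).
pose E := 'D_(dx K.+2) ('D_(dx K.+2) e) (x K.+2).
have CE : C = E + X2.
  have H := derive2_factor df e c (x K.+1) (u K.+1) (dx K.+1) (du K.+1)
    de dc ec.
  cbv zeta in H; rewrite (linS dx du _ lin K1N) (xS _ K1N) in H; exact: H.
have XE : X1 + X2 + E = C + X1.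
  by move: CE; move: X1 X2 E C => a b r _ ->; rewrite -addrA addrC (addrC b).
pose hT i y w := if i == K then Hamt L f fq phi y w (lam K.+1) mu
  else Ham L f y w (lam i.+1).
have sumT : \sum_(i < N) qform (hess_block (hT i) (x i) (u i))
    (col_mx (dx i) (du i)) = \sum_(i < N) A i + (C + X1).
  rewrite -(sum_at N K (C + X1) K0N) -big_split; apply: eq_bigr => i _.
  rewrite /hT /A /=.
  case: (eqVneq (i : nat) K) => [->|_]; last by rewrite addr0.
  have H := qform_Hamt dL df dc cE (lam K.+1) (x K) (u K) (dx K) (du K).
  cbv zeta in H; rewrite (linS dx du _ lin K0N) (xS _ K0N) in H; exact: H.
pose hO i y w := if i == K.+2 then Hamc L f phi y w (lam_s K.+3) mu
  else Ham L f y w (lam_s i.+1).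
have sumO : \sum_(i < N) qform (hess_block (hO i) (x i) (u i))
    (col_mx (dx i) (du i)) = \sum_(i < N) A i + (X1 + X2 + E).
  rewrite -(sum_at N K X1 K0N) -(sum_at N K.+1 X2 K1N) -(sum_at N K.+2 E K2N).
  rewrite -!big_split; apply: eq_bigr => i _ /=.
  have shift := qform_Ham_shift dL df (lam i.+1) (lam_s i.+1) (d i.+1)
    (x i) (u i) (dx i) (du i) erefl.
  rewrite /hO /A; case: (eqVneq (i : nat) K.+2) => [iK2|iK2].
    rewrite iK2 in shift *; rewrite !gtn_eqF ?(ltnW (ltnSn _))// !add0r.
    apply: etrans (qform_Hamc dL df phi mu (lam_s K.+3) (x K.+2) (u K.+2)
      (dx K.+2) (du K.+2) de) _.
    apply: etrans (congr1 (+%R^~ E) shift) _.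
    by rewrite dK3 mul0mx mxE addr0.
  rewrite addr0; apply: etrans shift _; congr (_ + _).
  have [->|iK] := eqVneq (i : nat) K.
    by rewrite ltn_eqF// addr0 d1.
  rewrite add0r; have [->|iK1] := eqVneq (i : nat) K.+1; first by rewrite d2.
  have -> : d i.+1 = 0.
    by apply: d0 => -[]; apply/eqP; [rewrite iK|rewrite iK1].
  by rewrite mul0mx mxE.
have sumOT : \sum_(i < N) qform (hess_block (hO i) (x i) (u i))
    (col_mx (dx i) (du i)) = \sum_(i < N) qform (hess_block (hT i) (x i) (u i))
    (col_mx (dx i) (du i)).
  exact: etrans sumO (etrans (congr1 (+%R _) XE) (esym sumT)).
(* [a] stands for the terminal term, common to both second variations. *)
have posO (a r s : R) : r = s -> 0 < a + s -> 0 < a + r by move=> ->.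
apply: (posO _ _ _ sumOT); apply: posT => /=.
(* It remains to check tangency for the transformed problem. By the linearised dynamics the left
   side is P dx_(k-1) = phi_x(x_k) (I + f_x) dx_(k-1), that is phi_x(x_k) dx_k - phi_x(x_k) f_u
   du_(k-1); the first term vanishes by [tan], the second by [jac_phi_jacu]. *)
move EP: (_ *m (1%:M + jac (gmap _) _)) => P.
rewrite -!mulmxA -mulmxDr (linS dx du _ lin K0N) -EP /next2 (xS _ K0N).
rewrite (jac_phi_next df dphi.1 f_form phi_q _ (u K.+1)).
rewrite (xS _ K1N) -mulmxA.
rewrite -(addrK (jacu f (x K.+1) (u K.+1) *m du K.+1) (_ *m dx _)).
rewrite (linS dx du _ lin K1N) mulmxBr tan sub0r mulmxA.
rewrite -[in X in X *m _](xS _ K1N).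
by rewrite (jac_phi_jacu df dphi.1 f_form phi_q) mul0mx oppr0.
Qed.
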